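(* Let $\mathbf F\subset\mathcal P_2(\mathsf{TX})$ be an MPVF and let $\mu\in D(\mathbf F)$ be such that $\mathbf F[\mu]$ is closed in $\mathcal P_2(\mathsf{TX})$ and satisfies the following total convexity property: for every $N\in\mathbb N$, if $\Lambda\in\mathcal P_2(\mathsf X\times\mathsf X^N)$ (with variables $(x,v_1,\dots,v_N)$ and projections $\mathsf x,\mathsf v_1,\dots,\mathsf v_N$) satisfies $(\mathsf x,\mathsf v_i)_\sharp\Lambda\in\mathbf F[\mu]$ for $i=1,\dots,N$, and $\alpha_i\ge0$, $i=1,\dots,N$, with $\sum_i\alpha_i=1$, then $(\mathsf x,\sum_i\alpha_i\mathsf v_i)_\sharp\Lambda\in\mathbf F[\mu]$. Then $\operatorname{bar}(\mathbf F)[\mu]\subset\mathbf F[\mu]$. In particular, if $\lambda\in\mathbb R$ and $\mathbf F$ is a maximal totally $\lambda$-dissipative MPVF, then $\operatorname{bar}(\mathbf F)\subset\mathbf F$.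
   Context: $\mathsf X$ is a separable (possibly infinite-dimensional) real Hilbert space. $\mathcal P_2(\cdot)$ denotes Borel probability measures with finite second moment, with the topology of the $L^2$-Wasserstein distance. $\mathsf{TX}=\mathsf X\times\mathsf X$ with projections $\mathsf x(x,v)=x$, $\mathsf v(x,v)=v$. A multivalued probability vector field (MPVF) is a nonempty subset $\mathbf F\subset\mathcal P_2(\mathsf{TX})$, with domain $D(\mathbf F)=\{\mathsf x_\sharp\Phi:\Phi\in\mathbf F\}$ and sections $\mathbf F[\mu]=\{\Phi\in\mathbf F:\mathsf x_\sharp\Phi=\mu\}$. $\mathbf F$ is totally $\lambda$-dissipative if $\int\langle v_1-v_0,x_1-x_0\rangle\,d\vartheta\le\lambda\int|x_1-x_0|^2\,d\vartheta$ for every $\Phi_0,\Phi_1\in\mathbf F$ and every coupling $\vartheta\in\Gamma(\Phi_0,\Phi_1)$ (variables $(x_0,v_0,x_1,v_1)$); maximal means maximal w.r.t. inclusion in this class. For $\Phi\in\mathcal P_2(\mathsf{TX})$ with $\mathsf x_\sharp\Phi=\mu$ and disintegration $\{\Phi_x\}_{x\in\mathsf X}$ w.r.t. $\mu$, the barycenter is $\boldsymbol b_\Phi(x)=\int_{\mathsf X}v\,d\Phi_x(v)$, $\boldsymbol b_\Phi\in L^2(\mathsf X,\mu;\mathsf X)$. Set $\operatorname{bar}(\Phi)=(\boldsymbol i,\boldsymbol b_\Phi)_\sharp\mu$ ($\boldsymbol i$ the identity map of $\mathsf X$), $\operatorname{bar}(\mathbf F)[\mu]=\{\operatorname{bar}(\Phi):\Phi\in\mathbf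 F[\mu]\}$ and $\operatorname{bar}(\mathbf F)=\bigcup_{\mu\in D(\mathbf F)}\operatorname{bar}(\mathbf F)[\mu]$. *)

(* Defs.v *)
From HB Require Import structures.
From mathcomp Require Import all_boot all_order all_algebra.
From mathcomp Require Import all_classical all_reals all_analysis.

Set Implicit Arguments.
Unset Strict Implicit.
Unset Printing Implicit Defensive.

Import Order.TTheory GRing.Theory Num.Theory.
Import numFieldNormedType.Exports.

Local Open Scope classical_set_scope.
Local Open Scope ring_scope.

(* join of the pointed and topological structures of a product, which the
   library leaves undeclared *)
HB.instance Definition _ (T U : ptopologicalType) := Pointed.on (T * U)%type.

(* Products of topological spaces carry the Borel sigma-algebra of the product
   topology, not the product of the Borel sigma-algebras (the two coincide when
   the factors are separable metric spaces). *)
Notation borel T := (g_sigma_algebraType (@open T)).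

Section borel_probabilities.
Context {R : realType}.

(* A [probability] of the library also assigns (meaningless) values to
   non-measurable sets, so Leibniz equality is finer than equality of measures:
   measures are compared on measurable sets only, and "f_# P = Q" is the
   relation [is_pushforward f P Q]. *)
Definition same_law {T : ptopologicalType} (P Q : probability (borel T) R) :=
  forall A : set (borel T), measurable A -> P A = Q A.

Definition is_pushforward {T U : ptopologicalType} (f : T -> U)
    (P : probability (borel T) R) (Q : probability (borel U) R) :=
  measurable_fun [set: borel T] (f : borel T -> borel U) /\
  forall A : set (borel U), measurable A ->
    Q A = pushforward P (f : borel T -> borel U) A.

(* f_# P \in S *)
Definition pushforward_in {T U : ptopologicalType} (f : T -> U)
    (P : probability (borel T) R) (S : set (probability (borel U) R)) :=
  exists2 Q, is_pushforward f P Q & S Q.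

Definition couplings {T U : ptopologicalType}
    (P : probability (borel T) R) (Q : probability (borel U) R) :
    set (probability (borel (T * U)%type) R) :=
  [set g | is_pushforward (fst : (T * U)%type -> T) g P /\
             is_pushforward (snd : (T * U)%type -> U) g Q].

End borel_probabilities.

Section mpvf.
Context {R : realType} (X : completeNormedModType R).
Local Notation TX := (X * X)%type.

(* The library norms a product by the maximum of the norms of the factors; the
   Hilbert norms of X * X and X * X^N are therefore spelled out. *)
Definition sqnormTX (z : TX) : R := `|z.1| ^+ 2 + `|z.2| ^+ 2.

Definition sqnormXN (N : nat) (z : X * 'rV[X]_N) : R :=
  `|z.1| ^+ 2 + \sum_(i < N) `|z.2 ord0 i| ^+ 2.

Definition P2TX : set (probability (borel TX) R) :=
  [set Phi : probability (borel TX) R |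
     (\int[Phi]_z (sqnormTX z)%:E < +oo)%E].

Definition P2XN (N : nat) : set (probability (borel (X * 'rV[X]_N)%type) R) :=
  [set L : probability (borel (X * 'rV[X]_N)%type) R |
     (\int[L]_z (sqnormXN z)%:E < +oo)%E].

Definition W2 (Phi Psi : probability (borel TX) R) : \bar R :=
  (ereal_inf [set (\int[g]_z (sqnormTX (z.1 - z.2))%:E)%E
             | g in couplings Phi Psi] `^ 2^-1)%E.

Definition W2closed (S : set (probability (borel TX) R)) :=
  forall Phi, P2TX Phi ->
    (forall e : R, 0 < e -> exists2 Psi, S Psi & (W2 Phi Psi < e%:E)%E) ->
  S Phi.

(* The last clause makes F a set of measures in spite of the finer Leibniz
   equality on [probability]. *)
Definition MPVF (F : set (probability (borel TX) R)) :=
  [/\ F !=set0, F `<=` P2TX &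
      forall Phi Psi, same_law Phi Psi -> F Phi -> F Psi].

Definition MPVFdom (F : set (probability (borel TX) R)) :
    set (probability (borel X) R) :=
  [set mu | exists2 Phi, F Phi & is_pushforward fst Phi mu].

Definition MPVFsection (F : set (probability (borel TX) R))
    (mu : probability (borel X) R) : set (probability (borel TX) R) :=
  [set Phi | F Phi /\ is_pushforward fst Phi mu].

Definition totally_dissipative (dot : {dot X for idfun}) (lambda : R)
    (F : set (probability (borel TX) R)) :=
  forall Phi0 Phi1, F Phi0 -> F Phi1 ->
  forall theta, couplings Phi0 Phi1 theta ->
  (\int[theta]_z (dot (z.2.2 - z.1.2) (z.2.1 - z.1.1))%:E <=
   lambda%:E * \int[theta]_z (`|z.2.1 - z.1.1| ^+ 2)%:E)%E.

Definition maximal_totally_dissipative (dot : {dot X for idfun}) (lambda : R)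
    (F : set (probability (borel TX) R)) :=
  [/\ MPVF F, totally_dissipative dot lambda F &
      forall G, MPVF G -> totally_dissipative dot lambda G ->
        F `<=` G -> G `<=` F].

Definition totally_convex (S : set (probability (borel TX) R)) :=
  forall (N : nat) (L : probability (borel (X * 'rV[X]_N)%type) R)
    (alpha : 'I_N -> R),
  P2XN L ->
  (forall i : 'I_N, pushforward_in (fun z : X * 'rV[X]_N => (z.1, z.2 ord0 i)) L S) ->
  (forall i, 0 <= alpha i) -> \sum_(i < N) alpha i = 1 ->
  pushforward_in
    (fun z : X * 'rV[X]_N => (z.1, \sum_(i < N) alpha i *: z.2 ord0 i)) L S.

(* m is the Bochner integral of the identity map with respect to P. *)
Definition is_mean (P : {measure set (borel X) -> \bar R}) (m : X) :=
  exists s : nat -> {fimfun X >-> X},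
  [/\ forall n, measurable_fun [set: borel X] (s n : borel X -> borel X),
      (fun n => \int[P]_v (`|(v : X) - s n v|)%:E)%E @ \oo --> 0%E &
      (fun n => \sum_(v \in range (s n)) fine (P (s n @^-1` [set v])) *: v)
        @ \oo --> m].

Definition is_disintegration (Phi : probability (borel TX) R)
    (mu : probability (borel X) R) (k : R.-pker (borel X) ~> (borel X)) :=
  forall A : set (borel TX), measurable A ->
    Phi A = (\int[mu]_x k x (xsection (A : set TX) x))%E.

(* b is a Borel representative of the barycenter of Phi, whose disintegration is
   determined up to a mu-null set. *)
Definition is_barycenter (Phi : probability (borel TX) R)
    (mu : probability (borel X) R) (b : X -> X) :=
  measurable_fun [set: borel X] (b : borel X -> borel X) /\
  exists2 k : R.-pker (borel X) ~> (borel X), is_disintegration Phi mu k &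
    {ae mu, forall x, is_mean (k x) (b x)}.

(* Psi = bar(Phi), where mu is the first marginal of Phi *)
Definition is_bar (Phi : probability (borel TX) R)
    (mu : probability (borel X) R) (Psi : probability (borel TX) R) :=
  exists2 b : X -> X, is_barycenter Phi mu b &
    is_pushforward (fun x => (x, b x)) mu Psi.

Definition bar_section (F : set (probability (borel TX) R))
    (mu : probability (borel X) R) : set (probability (borel TX) R) :=
  [set Psi | exists2 Phi, MPVFsection F mu Phi & is_bar Phi mu Psi].

Definition bar (F : set (probability (borel TX) R)) :
    set (probability (borel TX) R) :=
  \bigcup_(mu in MPVFdom F) bar_section F mu.

End mpvf.

(* Main.v *)
Require Import Defs.
From HB Require Import structures.
From mathcomp Require Import all_boot all_order all_algebra.
From mathcomp Require Import all_classical all_reals all_analysis.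
From mathcomp Require Import measurable_realfun ring lra.
Import Order.TTheory GRing.Theory Num.Theory.
Import numFieldNormedType.Exports.
Local Open Scope classical_set_scope.
Local Open Scope ring_scope.
Set Implicit Arguments.
Unset Strict Implicit.
Unset Printing Implicit Defensive.

(* Let k disintegrate Phi over mu.  If, given x, the velocities v1 and v2 are
   independent with law k x, total convexity (N = 2, weights 1/2) keeps the law
   of (x, (v1 + v2) / 2) in F[mu]; this operation preserves the barycenter and
   halves the variance around it.  Iterating it yields elements of F[mu] whose
   W2-distance to bar(Phi) tends to 0, and F[mu] is closed.

   For a maximal F neither closedness nor convexity is needed: a coupling of Xi
   with bar(Phi) lifts to a coupling of Xi with Phi by resampling the second
   velocity from k, which changes neither side of the dissipativity inequality.
   Hence F `|` bar F is totally dissipative, and maximality gives bar F `<=` F. *)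

(** * Borel measurability in second countable spaces *)

(** The obstacle is the integration of signed and vector-valued functions against kernels. Joint
    laws are therefore described by integrals of nonnegative functions only, whose iterated
    integrals always make sense. The Bochner mean enters through its scalar products alone
    ([is_mean_dot]) and is at once recast as the quadratic identity [mean_var]. The signed integral
    in the dissipativity inequality is recovered by polarization from three integrals of squares,
    finite because all laws involved have finite second moment. Separability of [X] acts through
    [measurable_borel_pair]: kernels live on products of Borel sigma-algebras, laws on the Borel
    sigma-algebra of the product, and second countability reconciles the two. *)

Lemma measurable_bigcup_countable d (T : measurableType d) (I : Type)
    (C : set I) (G : I -> set T) :
  countable C -> (forall i, C i -> measurable (G i)) ->
  measurable (\bigcup_(i in C) G i).
Proof.
move=> cC mG; rewrite bigcup_set_type; apply: countable_bigcupT_measurable.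
  by rewrite /= (eq_countable (card_setT C)).
by case=> i /= iC; apply: mG; rewrite inE in iC.
Qed.

Lemma second_countable_normed (R : realType) (V : normedModType R) :
  (exists2 D : set V, countable D & dense D) -> @second_countable V.
Proof.
move=> [D cD dD].
exists [set ball z.1 (z.2.+1%:R^-1 : R) | z in D `*` [set: nat]].
  exact/(sub_countable (card_image_le _ _))/countableX.
split=> [_ [z _ <-]|x A /nbhs_ballP[e /= e0 xA]]; first exact: ball_open.
(* Radius below [e / 2]: a ball of this radius around a point of [D] that contains [x] has all its
   points within [e] of [x]. *)
have [n ne] : exists n, n.+1%:R^-1 < e / 2 :> R.
  near \oo => n; exists n; near: n.
  by apply: near_infty_natSinv_lt (PosNum _); rewrite divr_gt0.
have n0 : 0 < n.+1%:R^-1 :> R by rewrite invr_gt0 ltr0n.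
have [y [xy Dy]] : ball x (n.+1%:R^-1 : R) `&` D !=set0.
  by apply: dD; [exists x; exact: ballxx|exact: ball_open].
exists (ball y (n.+1%:R^-1 : R)).
  split; last exact: ball_sym.
  by exists (y, n).
move=> z yz; apply: xA; apply: le_ball (ball_triangle xy yz).
by rewrite (splitr e) lerD// ltW.
Unshelve. all: by end_near. Qed.

Lemma second_countable_prod (T U : topologicalType) :
  @second_countable T -> @second_countable U -> @second_countable (T * U)%type.
Proof.
move=> [B cB [Bo Bn]] [C cC [Co Cn]].
exists [set z.1 `*` z.2 | z in B `*` C].
  exact/(sub_countable (card_image_le _ _))/countableX.
split=> [_ [z [/= Bz Cz] <-]|x A [[P Q] /= [/Bn[b [Bb bx] bP] /Cn[c [Cc cx] cQ]] PQA]].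
  rewrite openE => y [yz1 yz2]; exists z => //; split; apply: open_nbhs_nbhs.
    by split=> //; exact: Bo.
  by split=> //; exact: Co.
exists (b `*` c); first by split=> //; exists (b, c).
by move=> y [yb yc]; apply: PQA; split; [exact: bP|exact: cQ].
Qed.

Lemma continuous_pair (T U V : topologicalType) (f : T -> U) (g : T -> V) :
  continuous f -> continuous g -> continuous (fun z => (f z, g z)).
Proof. by move=> cf cg z; exact: cvg_pair (cf z) (cg z). Qed.

Lemma continuous_fst (T U : topologicalType) : continuous (@fst T U).
Proof. by move=> z; exact: cvg_fst. Qed.

Lemma continuous_snd (T U : topologicalType) : continuous (@snd T U).
Proof. by move=> z; exact: cvg_snd. Qed.

Section borel_measurability.
Context d (S : measurableType d) (R : realType).

Lemma borel_open (T : ptopologicalType) (A : set (borel T)) :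
  open (A : set T) -> measurable A.
Proof. exact: sub_sigma_algebra. Qed.

Lemma continuous_borel (T U : ptopologicalType) (f : T -> U) :
  continuous f -> measurable_fun [set: borel T] (f : borel T -> borel U).
Proof.
move=> cf; apply: (@measurability _ _ (borel T) (borel U) setT f (@open U)) => // _ [A oA <-].
by rewrite setTI; apply: borel_open; apply: open_comp => // x _; exact: cf.
Qed.

Lemma measurable_borel_fst (T U : ptopologicalType) :
  measurable_fun setT (fst : borel (T * U)%type -> borel T).
Proof. by apply: continuous_borel; exact: continuous_fst. Qed.

Lemma measurable_borel_snd (T U : ptopologicalType) :
  measurable_fun setT (snd : borel (T * U)%type -> borel U).
Proof. by apply: continuous_borel; exact: continuous_snd. Qed.

(** The sigma-algebra on [R] is the one declared for reals, not [borel R], so [continuous_borel]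
    does not apply; open intervals generate it. *)
Lemma continuous_borel_real (T : ptopologicalType) (f : T -> R) :
  continuous f -> measurable_fun [set: borel T] (f : borel T -> R).
Proof.
move=> cf; apply: (measurability _ (RGenOpens.measurableE R)) => // _ [_ [a [b ->]] <-].
rewrite setTI; apply: borel_open; apply: open_comp => [x _|]; first exact: cf.
exact: interval_open.
Qed.

(** An open set of [T * U] is a countable union of open rectangles taken from the two bases, and the
    preimage of a rectangle is an intersection of two measurable sets. *)
Lemma measurable_borel_pair (T U : ptopologicalType) (f : S -> borel T)
    (g : S -> borel U) :
  @second_countable T -> @second_countable U ->
  measurable_fun setT f -> measurable_fun setT g ->
  measurable_fun setT ((fun s => (f s, g s)) : S -> borel (T * U)%type).
Proof.
move=> [B cB [Bo Bn]] [C cC [Co Cn]] mf mg.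
apply: (@measurability _ _ S (borel (T * U)%type) setT _ (@open (T * U)%type)) 
  => // _ [A oA <-].
rewrite setTI.
rewrite [X in measurable X](_ : _ = \bigcup_(z in [set z | (B `*` C) z /\ z.1 `*` z.2 `<=` A])
    (f @^-1` z.1 `&` g @^-1` z.2)); last first.
  apply/seteqP; split=> s /=; last first.
    by move=> [z /= [_ zA] [fz gz]]; apply: zA.
  move=> As.
  have := open_nbhs_nbhs (conj oA As).
  move=> [[P Q] /= [/Bn[b [Bb bx] bP] /Cn[c [Cc cx] cQ]] PQA].
  exists (b, c) => //=; split; first by split.
  by move=> y [yb yc]; apply: PQA; split; [exact: bP|exact: cQ].
apply: measurable_bigcup_countable.
  by apply: sub_countable (countableX cB cC); apply: subset_card_le => z [].
move=> z [[Bz Cz] _]; apply: measurableI; rewrite -[X in measurable X]setTI.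
  by apply: mf => //; apply: borel_open; exact: Bo.
by apply: mg => //; apply: borel_open; exact: Co.
Qed.

End borel_measurability.

(** * Probability kernels *)

Section unit_mass.
Context d (T : measurableType d) (R : realType) (m : {measure set T -> \bar R}).

(** A named copy of [m]: carrying the proof [m1] as an argument, it can receive the probability
    structure as an instance. It turns the fibres [k x] of a kernel into probabilities. *)
Definition unit_mass (m1 : m setT = 1%E) : set T -> \bar R := m.

Variable m1 : m setT = 1%E.

HB.instance Definition _ := Measure.on (unit_mass m1).
HB.instance Definition _ := Measure_isProbability.Build _ _ _ (unit_mass m1) m1.

End unit_mass.

Lemma kernel_comp_measurable d1 d2 d3 (T : measurableType d1)
    (U : measurableType d2) (V : measurableType d3) (R : realType)
    (h : T -> U) (k : R.-pker U ~> V) :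
  measurable_fun setT h ->
  exists m : R.-pker T ~> V, forall x, m x = k (h x).
Proof.
move=> mh; pose m := (fun x => k (h x)) : T -> {measure set V -> \bar R}.
have mk A : measurable A -> measurable_fun setT (m ^~ A).
  by move=> mA; exact: measurableT_comp (measurable_kernel k A mA) mh.
pose m1 := isKernel.Build _ _ _ _ _ m mk.
pose mK : R.-ker T ~> V := HB.pack m m1.
have m1E x : mK x setT = 1%E by exact: prob_kernel.
pose m2 := Kernel_isProbability.Build _ _ _ _ _ mK m1E.
pose mP : R.-pker T ~> V := HB.pack m m1 m2.
by exists mP.
Qed.

(** The composition of two kernels of mass 1 has mass 1. *)
Lemma kernel_bind d1 d2 d3 (T : measurableType d1)
    (U : measurableType d2) (V : measurableType d3) (R : realType)
    (l : R.-pker T ~> U) (k : R.-pker (T * U) ~> V) :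
  exists m : R.-pker T ~> V, forall x (g : V -> \bar R), (forall v, 0 <= g v)%E ->
    measurable_fun setT g ->
    (\int[m x]_v g v = \int[l x]_u \int[k (x, u)]_v g v)%E.
Proof.
pose m : R.-ker T ~> V := mkcomp l k.
have m1E x : m x setT = 1%E.
  rewrite /m /= /kcomp /=; under eq_integral do rewrite prob_kernel.
  by rewrite integral_cst// mul1e prob_kernel.
pose m2 := Kernel_isProbability.Build _ _ _ _ _ m m1E.
pose mP : R.-pker T ~> V := HB.pack (Kernel.sort m) m2.
exists mP => x g g0 mg; exact: (integral_kcomp l k x g0 mg).
Qed.

Lemma kernel_map d1 d2 d3 (T : measurableType d1)
    (U : measurableType d2) (W : measurableType d3) (R : realType)
    (k : R.-pker T ~> U) (f : T * U -> W) :
  measurable_fun setT f ->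
  exists m : R.-pker T ~> W, forall x (g : W -> \bar R), (forall w, 0 <= g w)%E ->
    measurable_fun setT g ->
    (\int[m x]_w g w = \int[k x]_u g (f (x, u)))%E.
Proof.
move=> mf; have [m mE] := kernel_bind k (kdirac mf : R.-pker _ ~> _).
exists m => x g g0 mg; rewrite mE//; apply: eq_integral => u _.
by rewrite /= integral_dirac// diracT mul1e.
Qed.

(** Given [x], the samples [u] and [v] are independent, since [l1] ignores [u]. With [k = l] this
    draws two independent velocities from the same fibre. *)
Lemma kernel_map2 d1 d2 d3 d4 (T : measurableType d1) (U : measurableType d2)
    (V : measurableType d3) (W : measurableType d4) (R : realType)
    (k : R.-pker T ~> U) (l : R.-pker T ~> V)
    (f : T * U * V -> W) :
  measurable_fun setT f ->
  exists m : R.-pker T ~> W, forall x (g : W -> \bar R), (forall w, 0 <= g w)%E ->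
    measurable_fun setT g ->
    (\int[m x]_w g w = \int[k x]_u \int[l x]_v g (f (x, u, v)))%E.
Proof.
move=> mf.
have [l1 l1E] := kernel_comp_measurable l (@measurable_fst _ _ T U).
have [l2 l2E] := kernel_map l1 mf.
have [m mE] := kernel_bind k l2.
exists m => x g g0 mg; rewrite mE//; apply: eq_integral => u _.
by rewrite l2E// l1E.
Qed.

Lemma law_of_kernel d1 d2 d3 (T : measurableType d1)
    (U : measurableType d2) (W : measurableType d3) (R : realType)
    (P : probability T R) (k : R.-pker T ~> U) (f : T * U -> W) :
  measurable_fun setT f ->
  exists Q : probability W R, forall g : W -> \bar R, (forall w, 0 <= g w)%E ->
    measurable_fun setT g ->
    (\int[Q]_w g w = \int[P]_x \int[k x]_u g (f (x, u)))%E.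
Proof.
move=> mf.
(* [P] becomes a constant kernel on the one-point space, so that the joint law is again a
   composition of kernels, evaluated at [tt]. *)
pose c : unit -> probability T R := fun=> P.
have mc : measurable_fun setT (c : _ -> pprobability T R) by exact: measurable_cst.
have [k1 k1E] := kernel_map k mf.
have [k2 k2E] := kernel_comp_measurable k1 (@measurable_snd _ _ unit T).
have [m mE] := kernel_bind (kprobability mc : R.-pker _ ~> _) k2.
exists (@unit_mass _ _ _ (m tt) (prob_kernel tt)) => g g0 mg.
rewrite [LHS]mE//; apply: eq_integral => x _.
by rewrite k2E k1E.
Qed.

(** * Means and variances in a Hilbert space *)

Section inner_product.
Context (R : realType) (X : normedModType R) (dot : {dot X for idfun}).
Hypothesis dot_norm : forall x : X, dot x x = `|x| ^+ 2.

Lemma dotC u v : dot u v = dot v u.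
Proof. by rewrite hermC expr0 mul1r. Qed.

Lemma dotZl (a : R) u v : dot (a *: u) v = a * dot u v.
Proof. by have := @linearZl_LR _ _ _ _ _ _ dot v a u. Qed.

Lemma sqnormB u v : `|u - v| ^+ 2 = `|u| ^+ 2 + `|v| ^+ 2 - 2 * dot u v.
Proof.
rewrite -!dot_norm linearBl/= !linearBr/= (dotC v u).
by ring.
Qed.

(** Trades the signed product for squared norms; both the measurability of [dot] in one variable and
    the dissipativity integrals rest on it. *)
Lemma dot_polarization u v :
  dot u v = 2^-1 * (`|u| ^+ 2 + `|v| ^+ 2 - `|u - v| ^+ 2).
Proof. by rewrite sqnormB; field. Qed.

Lemma dot_le u v : `|dot u v| <= `|u| * `|v|.
Proof.
have [->|v0] := eqVneq v 0; first by rewrite linear0r normr0 mulr_ge0.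
rewrite -ler_sqr ?nnegrE ?mulr_ge0// real_normK ?num_real// exprMn.
(* Cauchy-Schwarz: this squared norm expands to [a ^+ 2 * (b ^+ 2 * a ^+ 2 - c ^+ 2)] in the
   notation set below. *)
have := sqr_ge0 `| `|v| ^+ 2 *: u - dot u v *: v|.
rewrite -dot_norm linearBl/= !linearBr/= !dotZl !(dotC _ (_ *: _)) !dotZl !dot_norm (dotC v u).
set a := `|v|; set b := `|u|; set c := dot u v.
have a0 : 0 < a ^+ 2 by rewrite exprn_gt0// normr_gt0.
rewrite [leRHS](_ : _ = a ^+ 2 * (b ^+ 2 * a ^+ 2 - c ^+ 2)); last by ring.
by rewrite pmulr_rge0// subr_ge0.
Qed.

End inner_product.

Section vector_valued_measurability.
Context d (S : measurableType d) (R : realType) (X : normedModType R).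
Hypothesis X_sc : @second_countable X.
Implicit Types f g : S -> borel X.

Lemma measurable_comp_continuous (T U : ptopologicalType) (h : T -> U)
    (f : S -> borel T) :
  continuous h -> measurable_fun setT f ->
  measurable_fun setT ((fun s => h (f s)) : S -> borel U).
Proof. by move=> /continuous_borel ch mf; exact: measurableT_comp ch mf. Qed.

Lemma measurable_vecB f g : measurable_fun setT f -> measurable_fun setT g ->
  measurable_fun setT ((fun s => (f s : X) - (g s : X)) : S -> borel X).
Proof.
move=> mf mg.
have cB : continuous (fun z : X * X => z.1 - z.2).
  by move=> z; apply: cvgB; [exact: cvg_fst|exact: cvg_snd].
have mfg := measurable_borel_pair X_sc X_sc mf mg.
exact: (measurable_comp_continuous cB mfg).
Qed.

Lemma measurable_vecD f g : measurable_fun setT f -> measurable_fun setT g ->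
  measurable_fun setT ((fun s => (f s : X) + (g s : X)) : S -> borel X).
Proof.
move=> mf mg.
have cB : continuous (fun z : X * X => z.1 + z.2).
  by move=> z; apply: cvgD; [exact: cvg_fst|exact: cvg_snd].
have mfg := measurable_borel_pair X_sc X_sc mf mg.
exact: (measurable_comp_continuous cB mfg).
Qed.

Lemma measurable_vecZ (a : R) f : measurable_fun setT f ->
  measurable_fun setT ((fun s => a *: (f s : X)) : S -> borel X).
Proof.
have cZ : continuous (fun z : X => a *: z) by exact: scaler_continuous.
exact: (measurable_comp_continuous cZ).
Qed.

Lemma measurable_vec_norm f : measurable_fun setT f ->
  measurable_fun setT (fun s => `|f s : X|).
Proof.
have cn : continuous (fun x : X => `|x|) by exact: norm_continuous.
exact: measurableT_comp (continuous_borel_real cn).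
Qed.

Lemma measurable_vec_sqnorm f : measurable_fun setT f ->
  measurable_fun setT (fun s => (`|f s : X| ^+ 2)%:E).
Proof.
by move=> mf; apply/measurable_EFinP/measurable_funX; exact: measurable_vec_norm.
Qed.

End vector_valued_measurability.

Section mean.
Context (R : realType) (X : completeNormedModType R) (dot : {dot X for idfun}).
Hypothesis dot_norm : forall x : X, dot x x = `|x| ^+ 2.
Hypothesis X_sc : @second_countable X.
Variable P : probability (borel X) R.

Let mid : measurable_fun [set: borel X] (id : borel X -> borel X).
Proof. exact: measurable_id. Qed.

Let mBr (w : X) :
  measurable_fun [set: borel X] ((fun v : borel X => (v : X) - w) : borel X -> borel X).
Proof. by apply: (measurable_vecB X_sc); [exact: mid|exact: measurable_cst]. Qed.

Lemma measurable_dotr (w : X) :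
  measurable_fun [set: borel X] (fun v : borel X => dot v w).
Proof.
under eq_fun do rewrite (dot_polarization dot_norm).
apply: measurable_funM => //; apply: measurable_funB; first apply: measurable_funD => //.
- by apply: measurable_funX; exact: measurable_vec_norm mid.
- by apply: measurable_funX; exact: measurable_vec_norm (mBr w).
Qed.

Lemma integral_dot_simple (s : {fimfun X >-> X}) (w : X) :
  measurable_fun [set: borel X] (s : borel X -> borel X) ->
  P.-integrable setT (fun v : borel X => (dot (s v) w)%:E) /\
  (\int[P]_v (dot (s (v : X)) w)%:E =
   (dot (\sum_(v \in range s) fine (P (s @^-1` [set v])) *: v) w)%:E)%E.
Proof.
move=> ms.
have fs : finite_set (range s) by exact: fimfunP.
have mpre (z : X) : measurable (s @^-1` [set z] : set (borel X)).
  rewrite -[X in measurable X]setTI; apply: ms => //.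
  rewrite -[X in measurable X]setCK; apply: measurableC; apply: borel_open.
  by rewrite openC; exact/accessible_closed_set1/hausdorff_accessible/norm_hausdorff.
(* Decomposition over the finite range of [s]; only the term with [z = s v] survives. *)
have sE (v : borel X) : (dot (s v) w)%:E =
    (\sum_(z <- finmap.enum_fset (fset_set (range s)))
       (dot z w)%:E * (\1_(s @^-1` [set z]) v)%:E)%E.
  rewrite -[RHS](@fsbig_finite _ _ _ _ (range s)
    (fun z => (dot z w)%:E * (\1_(s @^-1` [set z]) v)%:E)%E)//.
  rewrite (fsbigD1 (s v))//.
  rewrite /= indicE mem_set// mule1 fsbig1 ?adde0// => z [_ /= zv].
  by rewrite indicE memNset ?mule0// => /= vz; apply: zv; rewrite vz.
have int1 (z : X) : P.-integrable setT (fun v : borel X => (\1_(s @^-1` [set z]) v)%:E).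
  exact: integrable_indic.
have int2 (z : X) : P.-integrable setT
    (fun v : borel X => (dot z w)%:E * (\1_(s @^-1` [set z]) v)%:E)%E.
  exact: integrableZl.
split; first by rewrite (funext sE); exact: integrable_sum.
under eq_integral do rewrite sE.
rewrite integral_sum// fsbig_finite//=
  (big_morph (dot^~ w) (linearDl dot w) (linear0l dot w)) -sumEFin.
apply: eq_bigr => z _.
rewrite integralZl// integral_indic// setIT (dotZl dot) EFinM muleC fineK//.
exact: fin_num_measure.
Qed.

Hypothesis P2 : (\int[P]_v (`|(v : X)| ^+ 2)%:E < +oo)%E.

Lemma integrable_norm : P.-integrable setT (fun v : borel X => `|(v : X)|%:E).
Proof.
apply: (@le_integrable _ _ _ _ _ _ _ (fun v : borel X => (1 + `|(v : X)| ^+ 2)%:E)) => //.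
- by apply/measurable_EFinP; exact: measurable_vec_norm mid.
- move=> v _; rewrite !abse_EFin lee_fin normr_id ger0_norm ?addr_ge0 ?exprn_ge0//.
  by have := sqr_ge0 (`|(v : X)| - 1); nra.
- under eq_fun do rewrite EFinD; apply: integrableD => //.
    exact: finite_measure_integrable_cst.
  apply/integrableP; split; first exact: measurable_vec_sqnorm mid.
  by under eq_integral do rewrite abse_EFin ger0_norm ?exprn_ge0//.
Qed.

Lemma integrable_dotr w : P.-integrable setT (fun v : borel X => (dot (v : X) w)%:E).
Proof.
apply: (@le_integrable _ _ _ _ _ _ _ (fun v : borel X => (`|w|%:E * `|(v : X)|%:E)%E)) => //.
- by apply/measurable_EFinP; exact: measurable_dotr.
- move=> v _; rewrite -EFinM !abse_EFin lee_fin normrM !normr_id mulrC.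
  exact: (dot_le dot_norm).
- by apply: integrableZl => //; exact: integrable_norm.
Qed.

(** The form [dot _ w] is linear and bounded by Cauchy-Schwarz, so it passes through the limit of
    simple functions that defines the Bochner integral. *)
Lemma is_mean_dot (m w : X) : is_mean P m ->
  (\int[P]_v (dot (v : X) w)%:E)%E = (dot m w)%:E.
Proof.
move=> [s [ms s0 sm]].
have /fineK <- := integrable_fin_num measurableT (integrable_dotr w).
congr EFin; set I := fine _.
pose mn n := \sum_(v \in range (s n)) fine (P (s n @^-1` [set v])) *: v.
(* Finiteness is assumed because [fine] sends an infinite integral to 0; the convergence in
   [is_mean] ensures it only for large [n]. *)
have bound n : (\int[P]_v (`|(v : X) - s n v|)%:E < +oo)%E ->
    `|I - dot (mn n) w| <= `|w| * fine (\int[P]_v (`|(v : X) - s n v|)%:E)%E.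
  have mvs : measurable_fun [set: borel X]
      ((fun v : borel X => (v : X) - s n v) : borel X -> borel X).
    exact: measurable_vecB X_sc _ _ mid (ms n).
  move=> fin; have [is1 is2] := integral_dot_simple w (ms n).
  have fin' : (\int[P]_v (`|(v : X) - s n v|)%:E)%E \is a fin_num.
    by rewrite ge0_fin_numE// integral_ge0.
  rewrite -lee_fin EFinM fineK//.
  have -> : `|I - dot (mn n) w|%:E =
      `|\int[P]_v ((dot (v : X) w)%:E - (dot (s n v) w)%:E)|%E.
    rewrite integralB//; last exact: integrable_dotr.
    by rewrite is2 /I -(fineK (integrable_fin_num measurableT (integrable_dotr w))).
  rewrite -ge0_integralZl_EFin//; last first.
    by apply/measurable_EFinP; exact: measurable_vec_norm mvs.
  have mdB : measurable_fun [set: borel X]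
      (fun v : borel X => ((dot (v : X) w)%:E - (dot (s n v) w)%:E)%E).
    apply: emeasurable_funB; apply/measurable_EFinP; first exact: measurable_dotr.
    exact: measurableT_comp (measurable_dotr w) (ms n).
  apply: le_trans (le_abse_integral _ _ _) _ => //.
  apply: ge0_le_integral => //.
  - exact: measurableT_comp.
  - apply: measurable_funeM; apply/measurable_EFinP; exact: measurable_vec_norm mvs.
  - move=> v _; rewrite -EFinB abse_EFin lee_fin -linearBl/= mulrC.
    exact: (dot_le dot_norm).
apply/eqP; rewrite -subr_eq0 -normr_le0; apply/ler_addgt0Pr => e e0.
(* Two errors of at most [|w| * e'] each are to be added; the extra 1 keeps the denominator positive
   when [w = 0]. *)
pose e' := e / (2 * (`|w| + 1)).
have e'0 : 0 < e' by rewrite divr_gt0// mulr_gt0// ltr_wpDl.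
have := s0; move=> /fine_cvgP[s0fin s0cvg].
have c1 := cvgr_dist_lt _ _ s0cvg _ e'0.
have c2 := cvgr_dist_lt _ _ sm _ e'0.
near \oo => n.
have finn : (\int[P]_v (`|(v : X) - s n v|)%:E)%E \is a fin_num by near: n.
have h1 := bound n.
have {}h1 : `|I - dot (mn n) w| <= `|w| * fine (\int[P]_v (`|(v : X) - s n v|)%:E)%E.
  by apply: h1; rewrite ltey_eq finn.
have h2 : fine (\int[P]_v (`|(v : X) - s n v|)%:E)%E < e'.
  have : `|0 - fine (\int[P]_v (`|(v : X) - s n v|)%:E)%E| < e'.
    by near: n; exact: c1.
  by rewrite sub0r normrN; apply: le_lt_trans; rewrite ler_norm.
have h3 : `|m - mn n| < e' by near: n; exact: c2.
rewrite add0r -(subrKA (dot (mn n) w)) (le_trans (ler_normD _ _))//.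
have h4 : `|dot (mn n) w - dot m w| <= `|m - mn n| * `|w|.
  by rewrite -linearBl/= distrC; exact: (dot_le dot_norm).
apply: (@le_trans _ _ (2 * (`|w| + 1) * e')); last first.
  by rewrite /e' mulrC divfK// mulf_neq0// gt_eqF// ltr_wpDl.
have w0 : 0 <= `|w| by [].
by nra.
Unshelve. all: by end_near. Qed.

End mean.

(** * Image measures tested on nonnegative functions *)

Section pushforward_integrals.
Context (R : realType).
Implicit Types T U : ptopologicalType.

Lemma is_pushforward_integral T U (f : T -> U) (P : probability (borel T) R)
    (Q : probability (borel U) R) (g : borel U -> \bar R) :
  is_pushforward f P Q -> (forall y, 0 <= g y)%E -> measurable_fun setT g ->
  (\int[Q]_y g y = \int[P]_x g (f x))%E.
Proof.
move=> [mf QE] g0 mg.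
rewrite (eq_measure_integral (pushforward P (f : borel T -> borel U))).
  by rewrite ge0_integral_pushforward//.
by move=> A mA _; exact: QE.
Qed.

Lemma integral_is_pushforward T U (f : T -> U) (P : probability (borel T) R)
    (Q : probability (borel U) R) :
  measurable_fun setT (f : borel T -> borel U) ->
  (forall g : borel U -> \bar R, (forall y, 0 <= g y)%E -> measurable_fun setT g ->
    (\int[Q]_y g y = \int[P]_x g (f x))%E) ->
  is_pushforward f P Q.
Proof.
move=> mf QE; split=> // A mA.
have := QE (fun y => (\1_A y)%:E).
rewrite integral_indic// setIT => ->//; last first.
- by apply/measurable_EFinP; exact: measurable_indic.
- have mfA : measurable (f @^-1` A : set (borel T)).
    by rewrite -[X in measurable X]setTI; exact: mf.
- rewrite -[LHS]/(\int[P]_x (\1_(f @^-1` A) x)%:E)%E.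
  by rewrite integral_indic// setIT.
Qed.

Lemma is_pushforward_exists T U (f : T -> U) (P : probability (borel T) R) :
  measurable_fun setT (f : borel T -> borel U) ->
  exists Q : probability (borel U) R, is_pushforward f P Q.
Proof.
move=> mf.
have P1 : pushforward P (f : borel T -> borel U) setT = 1%E.
  by rewrite /pushforward preimage_setT probability_setT.
pose m : {measure set (borel U) -> \bar R} := pushforward P (f : borel T -> borel U).
by exists (@unit_mass _ _ _ (m mf) P1).
Qed.

Lemma is_pushforward_comp T U (V : ptopologicalType) (f : T -> U) (g : U -> V)
    (P : probability (borel T) R) (Q : probability (borel U) R)
    (Q' : probability (borel V) R) :
  is_pushforward f P Q -> is_pushforward g Q Q' ->
  is_pushforward (g \o f) P Q'.
Proof.
move=> [mf QE] [mg QE']; split; first exact: measurableT_comp mg mf.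
move=> A mA; rewrite QE'// /pushforward QE// -[X in measurable X]setTI.
exact: mg.
Qed.

(** Identifies the marginals of a coupling built as an image measure: the projection [g] is composed
    with the construction [f] and examined on the original space. *)
Lemma is_pushforward_factor T U (V : ptopologicalType) (f : T -> U) (g : U -> V)
    (P : probability (borel T) R) (Q : probability (borel U) R)
    (Q' : probability (borel V) R) :
  is_pushforward f P Q -> is_pushforward (g \o f) P Q' ->
  measurable_fun setT (g : borel U -> borel V) ->
  is_pushforward g Q Q'.
Proof.
move=> [mf QE] [mgf QE'] mg; split=> // A mA.
rewrite QE'// /pushforward QE// -[X in measurable X]setTI.
exact: mg.
Qed.

End pushforward_integrals.

(** * Pairs of velocities as row vectors *)

Section row_vectors.
Context (T : ptopologicalType).

Lemma row_coord_continuous n (i : 'I_n) :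
  continuous (fun M : 'rV[T]_n => M ord0 i).
Proof.
move=> M A MA; exists (fun i' j => if j == i then A else setT).
  by move=> i' j; rewrite !ord1; case: eqP => [->//|_]; exact: filterT.
by move=> N /(_ ord0 i); rewrite eqxx.
Qed.

Definition row2 (v w : T) : 'rV[T]_2 := \row_i (if i == ord0 then v else w).

Lemma row2_continuous : continuous (fun z : T * T => row2 z.1 z.2).
Proof.
move=> [v w] A [P MP PA].
have h0 := MP ord0 ord0; have h1 := MP ord0 ord_max.
rewrite !mxE/= in h0 h1.
exists (P ord0 ord0, P ord0 ord_max) => //= -[v' w'] [/= Pv Pw].
apply: PA => i j; rewrite !ord1 /row2 mxE.
by case: j => -[|[|//]] jlt /=; [rewrite (_ : Ordinal jlt = ord0)//|
  rewrite (_ : Ordinal jlt = ord_max)//]; exact/val_inj.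
Qed.

End row_vectors.

Section mean_and_variance.
Context (R : realType) (X : completeNormedModType R).
Hypothesis X_sc : @second_countable X.

(* P has barycenter b and variance V; testing the second moments around every
   point involves integrals of nonnegative functions only, which spares signed
   Fubini theorems. *)
Definition mean_var (P : set (borel X) -> \bar R) (b : X) (V : R) :=
  forall w : X,
    (\int[P]_v (`|(v : X) - w| ^+ 2)%:E = (V + `|b - w| ^+ 2)%:E)%E.

Let mid : measurable_fun [set: borel X] (id : borel X -> borel X).
Proof. exact: measurable_id. Qed.

Let msq (w : X) : measurable_fun setT (fun v : borel X => (`|(v : X) - w| ^+ 2)%:E).
Proof.
apply: measurable_vec_sqnorm; apply: (measurable_vecB X_sc); first exact: mid.
exact: measurable_cst.
Qed.

(** Expanding the square gives [A + |w|^2 - 2 * dot m w] around any [w], with [A] the second moment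
    around 0; the same formula at [w = m] evaluates the variance. *)
Lemma mean_var_mean (dot : {dot X for idfun})
    (dot_norm : forall x : X, dot x x = `|x| ^+ 2)
    (P : probability (borel X) R) (m : X) :
  (\int[P]_v (`|(v : X)| ^+ 2)%:E < +oo)%E -> is_mean P m ->
  mean_var P m (fine (\int[P]_v (`|(v : X) - m| ^+ 2)%:E)).
Proof.
move=> P2 Pm.
have iA : P.-integrable setT (fun v : borel X => (`|(v : X)| ^+ 2)%:E).
  apply/integrableP; split; first exact: measurable_vec_sqnorm mid.
  by under eq_integral do rewrite abse_EFin ger0_norm ?exprn_ge0//.
have /fineK AE := integrable_fin_num measurableT iA.
set A := fine _ in AE.
have E w : (\int[P]_v (`|(v : X) - w| ^+ 2)%:E = (A + `|w| ^+ 2 - 2 * dot m w)%:E)%E.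
  under eq_integral do rewrite (sqnormB dot_norm) EFinB EFinD (EFinM 2).
  have id2 := integrable_dotr dot_norm X_sc P2 w.
  have ic : P.-integrable setT (fun=> (`|w| ^+ 2)%:E).
    exact: finite_measure_integrable_cst.
  rewrite integralB//; [|exact: integrableD|exact: integrableZl].
  rewrite integralD// integralZl// integral_cst//.
  rewrite [X in (_ * X)%E](_ : _ = 1%E) ?mule1; last exact: probability_setT.
  by rewrite (is_mean_dot dot_norm X_sc P2 w Pm) -AE.
move=> w; rewrite !E /=; congr EFin; rewrite (sqnormB dot_norm) -(dot_norm m).
by ring.
Qed.

Lemma mean_var_average (P Q : {measure set (borel X) -> \bar R}) (b : X) (V : R) :
  P setT = 1%E -> mean_var P b V ->
  (forall g : borel X -> \bar R, (forall v, 0 <= g v)%E ->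
     measurable_fun setT g ->
     \int[Q]_v g v =
       \int[P]_u \int[P]_v g (2^-1 *: (u : X) + 2^-1 *: (v : X))%R)%E ->
  mean_var Q b (V / 2).
Proof.
move=> P1 PV QE w; rewrite QE; [|by move=> v; rewrite lee_fin|exact: msq].
(* For fixed [u], the point [(u + v) / 2 - w] is half of [v - (2 w - u)], so [PV] applies at
   [2 w - u]. The remaining norm is the distance from [u] to [2 w - b], where [PV] applies a second
   time; in total [(V + V + |2 (b - w)|^2) / 4]. *)
have inner (u : X) : (\int[P]_v (`|2^-1 *: (u : X) + 2^-1 *: (v : X) - w| ^+ 2)%:E =
    (4^-1 * V)%:E + (4^-1)%:E * (`|u - (2 *: w - b)| ^+ 2)%:E)%E.
  rewrite -EFinM -EFinD -mulrDr.
  transitivity (\int[P]_v ((4^-1)%:E * (`|(v : X) - (2 *: w - u)| ^+ 2)%:E))%E.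
    apply: eq_integral => v _; rewrite -EFinM; congr EFin.
    rewrite [in LHS](_ : _ - w = 2^-1 *: ((v : X) - (2 *: w - u))); last first.
      rewrite !scalerBr scalerA mulVf// scale1r.
      by rewrite opprB addrA addrAC (addrC (2^-1 *: u)) addrAC.
    rewrite normrZ exprMn ger0_norm//.
    by congr (_ * _); rewrite exprVn -natrX.
  rewrite ge0_integralZl_EFin; [|by []|by move=> v _; rewrite lee_fin|exact: msq|by []].
  rewrite PV -EFinM; congr (4^-1 * (V + `|_| ^+ 2))%:E.
  by rewrite !opprB addrCA.
under eq_integral do rewrite inner.
have V0 : 0 <= V.
  have := PV b; rewrite subrr normr0 expr0n addr0 -lee_fin => <-.
  by apply: integral_ge0 => v _; rewrite lee_fin.
rewrite ge0_integralD//; last 2 first.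
- by move=> u _; rewrite lee_fin mulr_ge0.
- by apply: measurable_funeM; exact: msq.
rewrite integral_cst// P1 mule1 ge0_integralZl_EFin;
  [|by []|by move=> v _; rewrite lee_fin|exact: msq|by []].
rewrite PV -EFinM -EFinD; congr EFin.
rewrite [b - _](_ : _ = 2 *: (b - w)); last first.
  by rewrite opprB addrA -mulr2n scalerBr -scaler_nat.
by rewrite normrZ ger0_norm// exprMn; field.
Qed.

End mean_and_variance.

(** * Disintegrations and barycenters *)

Section kernels_on_borel_spaces.
Context (R : realType) (T U : ptopologicalType).
Hypotheses (T_sc : @second_countable T) (U_sc : @second_countable U).
Implicit Type k : R.-pker (borel T) ~> (borel U).

(** The identity, from the product of the Borel sigma-algebras to the Borel sigma-algebra of the
    product. *)
Lemma measurable_pair_id :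
  measurable_fun [set: (borel T * borel U)%type]
    ((fun z => (z.1, z.2)) : borel T * borel U -> borel (T * U)%type).
Proof.
exact: measurable_borel_pair T_sc U_sc (@measurable_fst _ _ _ _) (@measurable_snd _ _ _ _).
Qed.

Lemma measurable_kernel_integral k (g : borel (T * U)%type -> \bar R) :
  (forall z, 0 <= g z)%E -> measurable_fun setT g ->
  measurable_fun setT (fun x : borel T => \int[k x]_u g ((x : T), (u : U)))%E.
Proof.
move=> g0 mg.
exact: (measurable_fun_integral_finite_kernel (fun z : borel T * borel U => g (z.1, z.2)) k
  (fun z => g0 _) (measurableT_comp mg measurable_pair_id)).
Qed.

Lemma measurable_slice (g : borel (T * U)%type -> \bar R) (x : T) :
  measurable_fun setT g -> measurable_fun setT (fun u : borel U => g (x, (u : U))).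
Proof.
move=> mg; apply: measurableT_comp mg _.
by apply: measurable_borel_pair => //; exact: measurable_id.
Qed.

(** The disintegration formula for all nonnegative Borel functions, where [is_disintegration] has it
    for sets. *)
Definition law_from_kernel (mu : probability (borel T) R) k
    (Phi : probability (borel (T * U)%type) R) :=
  forall g : borel (T * U)%type -> \bar R, (forall z, 0 <= g z)%E ->
    measurable_fun setT g ->
    (\int[Phi]_z g z = \int[mu]_x \int[k x]_u g ((x : T), (u : U)))%E.

Lemma law_from_kernel_exists (mu : probability (borel T) R) k :
  exists Phi, law_from_kernel mu k Phi.
Proof.
exact: (law_of_kernel mu k measurable_pair_id).
Qed.

Lemma law_from_kernel_fst (mu : probability (borel T) R) k Phi :
  law_from_kernel mu k Phi -> is_pushforward fst Phi mu.
Proof.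
move=> PhiE; have mfst := @measurable_borel_fst T U.
apply: integral_is_pushforward => // g g0 mg.
rewrite (PhiE (g \o fst)); [|by move=> z; exact: g0|exact: measurableT_comp].
apply: eq_integral => x _.
by rewrite /= integral_cst// prob_kernel mule1.
Qed.

End kernels_on_borel_spaces.

Section barycenters.
Context (R : realType) (X : completeNormedModType R) (dot : {dot X for idfun}).
Hypothesis dot_norm : forall x : X, dot x x = `|x| ^+ 2.
Hypothesis X_sc : @second_countable X.
Implicit Types (mu : probability (borel X) R) (Phi Psi : probability (borel (X * X)%type) R).
Implicit Types (k : R.-pker (borel X) ~> (borel X)) (b : borel X -> borel X).

(** The law [Q] built from [mu] and [k] satisfies the formula for functions by construction, and it
    agrees with [Phi] on measurable sets. Comparing [Q] with [Phi] replaces an approximation of [g]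
    by simple functions. *)
Lemma disintegration_law mu k Phi :
  is_disintegration Phi mu k -> law_from_kernel mu k Phi.
Proof.
move=> PhiE g g0 mg.
have [Q QE] := law_from_kernel_exists X_sc X_sc mu k.
rewrite -QE//; apply: eq_measure_integral => A mA _.
have mI : measurable_fun setT (fun z : borel (X * X)%type => (\1_A z)%:E : \bar R).
  by apply/measurable_EFinP; exact: measurable_indic.
have QA : Q A = (\int[Q]_z (\1_A z)%:E)%E by rewrite integral_indic// setIT.
rewrite [LHS]PhiE// [RHS]QA QE//; apply: eq_integral => x _.
(* The section is the set where the slice of the indicator of [A] equals 1. *)
have mxA : measurable (xsection (A : set (X * X)) x : set (borel X)).
  have := measurable_slice X_sc X_sc x mI.
  move=> /(_ measurableT [set 1%:E] (emeasurable_set1 _)); rewrite setTI.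
  congr measurable; apply/seteqP; split=> v /=; rewrite indicE /xsection/=.
    by case: (_ \in A) => // -[] /eqP; rewrite eq_sym oner_eq0.
  by move=> ->.
rewrite -[in LHS](setIT (xsection _ _)) -integral_indic//.
apply: eq_integral => v _; rewrite !indicE; congr (_%:R%:E).
by rewrite mem_xsection.
Qed.

Lemma measurable_sqdist_graph b : measurable_fun setT b ->
  measurable_fun setT (fun z : borel (X * X)%type => (`|z.2 - b z.1| ^+ 2)%:E : \bar R).
Proof.
move=> mb; apply: measurable_vec_sqnorm; apply: (measurable_vecB X_sc).
  exact: measurable_borel_snd.
exact: measurableT_comp mb (@measurable_borel_fst _ _).
Qed.

Lemma measurable_kernel_variance k b : measurable_fun setT b ->
  measurable_fun setT
    (fun x : borel X => \int[k x]_v (`|(v : X) - b x| ^+ 2)%:E)%E.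
Proof.
move=> /measurable_sqdist_graph mb.
by apply: (measurable_kernel_integral X_sc X_sc k _ mb) => z; rewrite lee_fin.
Qed.

Lemma measurable_sqnormTX :
  measurable_fun setT (fun z : borel (X * X)%type => (sqnormTX z)%:E).
Proof.
apply/measurable_EFinP; apply: measurable_funD; apply: measurable_funX;
  apply: measurable_vec_norm; [exact: measurable_borel_fst|exact: measurable_borel_snd].
Qed.

(** For almost every [x], the second moment of [k x] splits as [V x + |b x|^2], and it is finite
    because [Phi] has finite second moment. Dropping either term gives one of the two bounds. *)
Lemma barycenter_variance mu k Phi b :
  law_from_kernel mu k Phi -> P2TX Phi -> measurable_fun setT b ->
  {ae mu, forall x, is_mean (k x) (b x)} ->
  exists V : X -> R,
    [/\ {ae mu, forall x, mean_var (k x) (b x) (V x)},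
        (\int[mu]_x \int[k x]_v (`|(v : X) - b x| ^+ 2)%:E < +oo)%E &
        (\int[mu]_x (`|b x : X| ^+ 2)%:E <= \int[Phi]_z (`|z.2 : X| ^+ 2)%:E)%E].
Proof.
move=> PhiE Phi2 mb bE.
have m2 : measurable_fun setT (fun z : borel (X * X)%type => (`|z.2 : X| ^+ 2)%:E : \bar R).
  by apply: measurable_vec_sqnorm; exact: measurable_borel_snd.
have nn2 (z : borel (X * X)%type) : (0 <= (`|z.2 : X| ^+ 2)%:E :> \bar R)%E by rewrite lee_fin.
have s2 : (\int[Phi]_z (`|z.2 : X| ^+ 2)%:E < +oo)%E.
  apply: le_lt_trans Phi2; apply: ge0_le_integral => //; first exact: measurable_sqnormTX.
  by move=> z _; rewrite lee_fin lerDr.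
have S2E := PhiE _ nn2 m2.
have mS := measurable_kernel_integral X_sc X_sc k nn2 m2.
(* [fine] makes [V] real-valued; the fibres of infinite variance, where it returns 0, form a null
   set. *)
pose V x := fine (\int[k x]_v (`|(v : X) - b x| ^+ 2)%:E)%E.
have aefin : {ae mu, forall x, (\int[k x]_v (`|(v : X)| ^+ 2)%:E < +oo)%E}.
  have iS : mu.-integrable setT (fun x : borel X => \int[k x]_v (`|(v : X)| ^+ 2)%:E)%E.
    apply/integrableP; split => //.
    under eq_integral do rewrite gee0_abs ?integral_ge0//.
    by rewrite -S2E.
  apply: filterS (integrable_ae measurableT iS) => x /(_ Logic.I).
  by rewrite fin_numE => /andP[_]; rewrite ltey.
have aeV : {ae mu, forall x, mean_var (k x) (b x) (V x)}.
  apply: filterS2 bE aefin => x bx fx.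
  exact: (mean_var_mean X_sc dot_norm (P := unit_mass (prob_kernel x)) fx bx).
have V0 x : mean_var (k x) (b x) (V x) ->
    (\int[k x]_v (`|(v : X)| ^+ 2)%:E = (V x + `|b x : X| ^+ 2)%:E)%E.
  move=> /(_ 0); rewrite subr0 => <-.
  by apply: eq_integral => v _; rewrite subr0.
exists V; split => //.
  apply: (@le_lt_trans _ _ (\int[mu]_x \int[k x]_v (`|(v : X)| ^+ 2)%:E)%E); last by rewrite -S2E.
  apply: ae_ge0_le_integral => //.
  - by move=> x _; apply: integral_ge0.
  - exact: measurable_kernel_variance.
  - by move=> x _; apply: integral_ge0.
  - apply: filterS aeV => x Vx _.
    by rewrite V0// Vx subrr normr0 expr0n addr0 lee_fin lerDl.
rewrite S2E; apply: ae_ge0_le_integral => //.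
- exact: measurable_vec_sqnorm.
- by move=> x _; apply: integral_ge0.
- apply: filterS aeV => x Vx _.
  rewrite V0// lee_fin lerDr.
  have := Vx (b x); rewrite subrr normr0 expr0n addr0 -lee_fin => <-.
  by apply: integral_ge0 => v _; rewrite lee_fin.
Qed.

End barycenters.

(** * Averaging two conditionally independent velocities *)

Section averaging.
Context (R : realType) (X : completeNormedModType R).
Hypothesis X_sc : @second_countable X.
Variables (mu : probability (borel X) R) (S : set (probability (borel (X * X)%type) R)).
Hypotheses (S_P2 : S `<=` @P2TX R X) (S_convex : totally_convex S).
Implicit Types (k : R.-pker (borel X) ~> (borel X)).

Let m1 : measurable_fun setT (fun z : borel X * borel X * borel X => z.1.1).
Proof. exact: measurableT_comp measurable_fst measurable_fst. Qed.
Let m2 : measurable_fun setT (fun z : borel X * borel X * borel X => z.1.2).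
Proof. exact: measurableT_comp measurable_snd measurable_fst. Qed.
Let m3 : measurable_fun setT (fun z : borel X * borel X * borel X => z.2).
Proof. exact: measurable_snd. Qed.

Let rowmap (z : borel X * borel X * borel X) : borel (X * 'rV[X]_2)%type :=
  ((z.1.1 : X), row2 (z.1.2 : X) (z.2 : X)).

Let mrowmap : measurable_fun setT rowmap.
Proof.
(* The row is a continuous image of a pair, so second countability is called on only for products of
   copies of [X]. *)
have c : continuous (fun y : X * (X * X) => (y.1, row2 y.2.1 y.2.2)).
  apply: continuous_pair; first exact: continuous_fst.
  move=> y; apply: (@continuous_comp _ _ _ snd (fun w : X * X => row2 w.1 w.2) y).
    exact: cvg_snd.
  exact: row2_continuous.
have m := measurable_borel_pair X_sc (second_countable_prod X_sc X_sc) m1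
  (measurable_borel_pair X_sc X_sc m2 m3).
exact: measurable_comp_continuous c m.
Qed.

(** Total convexity yields [Phi'] without any disintegration. The kernel [k'] is constructed
    separately, as the fibrewise law of the average, and then matched with [Phi'] by computing both
    integrals through [L]. *)
Lemma average_step k Phi :
  law_from_kernel mu k Phi -> S Phi ->
  exists k' Phi', [/\ law_from_kernel mu k' Phi', S Phi' &
    forall x (g : borel X -> \bar R), (forall v, 0 <= g v)%E ->
      measurable_fun setT g ->
      (\int[k' x]_v g v =
       \int[k x]_u \int[k x]_v g (2^-1 *: (u : X) + 2^-1 *: (v : X))%R)%E].
Proof.
move=> PhiE SPhi.
have [l lE] := kernel_map2 k k mrowmap.
have [L LE] := law_of_kernel mu l (@measurable_snd _ _ (borel X) _).
have {}LE (g : borel (X * 'rV[X]_2)%type -> \bar R) : (forall z, 0 <= g z)%E ->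
    measurable_fun setT g ->
    (\int[L]_z g z =
     \int[mu]_x \int[k x]_u \int[k x]_v g ((x : X), row2 (u : X) (v : X)))%E.
  by move=> g0 mg; rewrite LE//; apply: eq_integral => x _; rewrite lE.
have mcoord (i : 'I_2) : measurable_fun setT
    ((fun z => (z.1, z.2 ord0 i)) : borel (X * 'rV[X]_2)%type -> borel (X * X)%type).
  apply: continuous_borel; apply: continuous_pair; first exact: continuous_fst.
  move=> z; apply: (@continuous_comp _ _ _ snd (fun M : 'rV[X]_2 => M ord0 i) z).
    exact: cvg_snd.
  exact: row_coord_continuous.
(* The velocity that does not occur integrates out, its kernel having mass 1. *)
have LPhi (i : 'I_2) :
    is_pushforward (fun z : X * 'rV[X]_2 => (z.1, z.2 ord0 i)) L Phi.
  apply: integral_is_pushforward => // g g0 mg.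
  rewrite (LE (fun z => g (z.1, z.2 ord0 i)));
    [|by move=> z; exact: g0|exact: measurableT_comp mg (mcoord i)].
  rewrite (PhiE g g0 mg); apply: eq_integral => x _ /=.
  under [in RHS]eq_integral do under eq_integral do rewrite /row2 mxE.
  case: (eqVneq i ord0) => _.
    apply: eq_integral => u _.
    by rewrite integral_cst// prob_kernel mule1.
  by rewrite integral_cst// prob_kernel mule1.
have L2 : P2XN L.
  have ms (i : 'I_2) := measurableT_comp (@measurable_sqnormTX R X) (mcoord i).
  have Li (i : 'I_2) : (\int[L]_z (sqnormTX (z.1, z.2 ord0 i))%:E < +oo)%E.
    have := S_P2 SPhi; rewrite /P2TX/=.
    rewrite (is_pushforward_integral (LPhi i)) => [//|z|].
      by rewrite lee_fin addr_ge0.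
    exact: measurable_sqnormTX.
  apply: (@le_lt_trans _ _ (\int[L]_z
      ((sqnormTX (z.1, z.2 ord0 ord0))%:E + (sqnormTX (z.1, z.2 ord0 ord_max))%:E))%E).
    apply: ge0_le_integral => //.
    - by move=> z _; rewrite lee_fin addr_ge0// sumr_ge0.
    (* Measurability of [sqnormXN]: the two pair norms count [|x|^2] twice, so one copy is
       subtracted. *)
    - apply: (eq_measurable_fun (fun z : borel (X * 'rV[X]_2)%type =>
        ((sqnormTX (z.1, z.2 ord0 ord0))%:E + ((sqnormTX (z.1, z.2 ord0 ord_max))%:E -
          (`|z.1 : X| ^+ 2)%:E))%E)).
        move=> z _; rewrite -EFinB -EFinD; congr EFin.
        rewrite /sqnormXN /sqnormTX/= big_ord_recr big_ord1/=.
        rewrite (_ : widen_ord _ _ = ord0); last exact/val_inj.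
        by ring.
      apply: emeasurable_funD; first exact: ms.
      apply: emeasurable_funB; first exact: ms.
      by apply: measurable_vec_sqnorm; exact: measurable_borel_fst.
    - by apply: emeasurable_funD; exact: ms.
    - move=> z _; rewrite -EFinD lee_fin /sqnormXN /sqnormTX/= big_ord_recr big_ord1/=.
      rewrite (_ : widen_ord _ _ = ord0); last exact/val_inj.
      by have := sqr_ge0 `|z.1|; lra.
  rewrite ge0_integralD//; last 4 first.
  - by move=> z _; rewrite lee_fin addr_ge0.
  - exact: ms.
  - by move=> z _; rewrite lee_fin addr_ge0.
  - exact: ms.
  by rewrite lte_add_pinfty// Li.
have half_sum : \sum_(i < 2) (2^-1 : R) = 1.
  by rewrite sumr_const card_ord -[_ *+ 2]mulr_natr mulVf.
have half_ge0 (i : 'I_2) : 0 <= 2^-1 :> R by [].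
have [Phi' LPhi' SPhi'] := S_convex L2 (fun i => ex_intro2 _ _ Phi (LPhi i) SPhi)
  half_ge0 half_sum.
have mavg : measurable_fun setT ((fun z => 2^-1 *: (z.1.2 : X) + 2^-1 *: (z.2 : X))
    : borel X * borel X * borel X -> borel X).
  by apply: (measurable_vecD X_sc); exact: measurable_vecZ.
have [k' k'E] := kernel_map2 k k mavg.
exists k', Phi'; split => // g g0 mg.
have := LE _ (fun z => g0 _) (measurableT_comp mg LPhi'.1).
rewrite (is_pushforward_integral LPhi' g0 mg) => ->.
have mgx (x : X) := measurable_slice X_sc X_sc x mg.
apply: eq_integral => x _; rewrite (k'E x _ (fun v => g0 _) (mgx x)).
apply: eq_integral => u _; apply: eq_integral => v _ /=.
rewrite big_ord_recr big_ord1/= !mxE.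
by rewrite (_ : widen_ord _ _ = ord0)//; exact/val_inj.
Qed.

Lemma average_iter k0 Phi0 (b : X -> X) (V : X -> R) n :
  law_from_kernel mu k0 Phi0 -> S Phi0 ->
  {ae mu, forall x, mean_var (k0 x) (b x) (V x)} ->
  exists k Phi, [/\ law_from_kernel mu k Phi, S Phi &
    {ae mu, forall x, mean_var (k x) (b x) (V x / 2 ^+ n)}].
Proof.
move=> Phi0E SPhi0 k0V; elim: n => [|n [k [Phi [PhiE SPhi kV]]]].
  exists k0, Phi0; split => //.
  by apply: filterS k0V => x; rewrite expr0 divr1.
have [k' [Phi' [Phi'E SPhi' k'E]]] := average_step PhiE SPhi.
exists k', Phi'; split => //; apply: filterS kV => x kxV.
rewrite exprS invfM mulrA mulrAC.
exact: mean_var_average (prob_kernel x) kxV (k'E x).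
Qed.

End averaging.

(** * Approximation of the barycentric projection in [W2] *)

Section projections_to_barycenters.
Context (R : realType) (X : completeNormedModType R) (dot : {dot X for idfun}).
Hypothesis dot_norm : forall x : X, dot x x = `|x| ^+ 2.
Hypothesis X_sc : @second_countable X.
Implicit Types (mu : probability (borel X) R) (Phi Psi : probability (borel (X * X)%type) R).

Lemma measurable_sqnormTX_dist :
  measurable_fun setT
    (fun z : borel ((X * X) * (X * X))%type => (sqnormTX (z.1 - z.2))%:E).
Proof.
apply: measurableT_comp (@measurable_sqnormTX R X) _; apply: continuous_borel => z.
by apply: cvgB; [exact: cvg_fst|exact: cvg_snd].
Qed.

Lemma W2_lt_coupling Phi Psi g (r e : R) :
  couplings Phi Psi g -> (\int[g]_z (sqnormTX (z.1 - z.2))%:E <= r%:E)%E ->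
  0 < e -> r < e ^+ 2 -> (W2 Phi Psi < e%:E)%E.
Proof.
move=> gc gr e0 re.
have cost_ge0 (h : probability (borel ((X * X) * (X * X))%type) R) :
    (0 <= \int[h]_z (sqnormTX (z.1 - z.2))%:E)%E.
  by apply: integral_ge0 => z _; rewrite lee_fin addr_ge0.
have r0 : 0 <= r by rewrite -lee_fin; exact: le_trans (cost_ge0 g) gr.
set I := [set (\int[h]_z (sqnormTX (z.1 - z.2))%:E)%E | h in couplings Phi Psi].
have I0 : (0 <= ereal_inf I)%E by apply: le_ereal_inf_tmp => _ [h _ <-]; exact: cost_ge0.
have Ir : (ereal_inf I <= r%:E)%E.
  by apply: le_trans gr; apply: ereal_inf_lbound; exists g.
rewrite /W2 -/I; apply: (@le_lt_trans _ _ (r%:E `^ 2^-1)%E).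
  by apply: gt0_ler_poweR => //; rewrite in_itv/= ?leey ?andbT// lee_fin.
rewrite poweR_EFin lte_fin powR12_sqrt//.
by rewrite -[ltRHS]ger0_norm ?ltW// -sqrtr_sqr ltr_sqrt// exprn_gt0.
Qed.

(** Jensen's inequality for the barycenter, which is the last bound of [barycenter_variance]. *)
Lemma P2TX_bar mu Phi Psi :
  is_pushforward fst Phi mu -> P2TX Phi -> is_bar Phi mu Psi -> P2TX Psi.
Proof.
move=> Phimu Phi2 [b [mb [k kE bE]] bPsi].
have [V [_ _ bV]] := barycenter_variance dot_norm X_sc (disintegration_law X_sc kE) Phi2 mb bE.
have mX : measurable_fun setT (fun x : borel X => (`|x : X| ^+ 2)%:E : \bar R).
  by apply: measurable_vec_sqnorm; exact: measurable_id.
have mf : measurable_fun setT (fst : borel (X * X)%type -> borel X).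
  exact: measurable_borel_fst.
have ms : measurable_fun setT (snd : borel (X * X)%type -> borel X).
  exact: measurable_borel_snd.
rewrite /P2TX/= (is_pushforward_integral bPsi);
  [|by move=> z; rewrite lee_fin addr_ge0|exact: measurable_sqnormTX].
rewrite /sqnormTX/=; under eq_integral do rewrite EFinD.
rewrite ge0_integralD//; last exact: measurable_vec_sqnorm.
rewrite (is_pushforward_integral Phimu)//.
apply: le_lt_trans (leeD2l _ bV) _; rewrite -ge0_integralD//.
- exact: measurable_vec_sqnorm.
- exact: measurable_vec_sqnorm.
Qed.

(** The coupling is the image of [Phi] under [z |-> ((z.1, b z.1), z)]. Positions do not move, so
    only the distance of the velocity to the barycenter is paid. *)
Lemma coupling_with_bar mu k Phi Psi (b : borel X -> borel X) :
  law_from_kernel mu k Phi -> measurable_fun setT b ->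
  is_pushforward (fun x : X => (x, b x)) mu Psi ->
  exists2 g, couplings Psi Phi g &
    (\int[g]_z (sqnormTX (z.1 - z.2))%:E =
     \int[mu]_x \int[k x]_v (`|(v : X) - b x| ^+ 2)%:E)%E.
Proof.
move=> PhiE mb bPsi.
have Phimu := law_from_kernel_fst PhiE.
have mf : measurable_fun setT (fst : borel (X * X)%type -> borel X).
  exact: measurable_borel_fst.
have mbar : measurable_fun setT
    ((fun x => ((x : X), (b x : X))) : borel X -> borel (X * X)%type).
  by apply: measurable_borel_pair => //; exact: measurable_id.
have mid2 : measurable_fun setT (id : borel (X * X)%type -> borel (X * X)%type).
  exact: measurable_id.
have mbar1 := measurableT_comp mbar mf.
have XX_sc := second_countable_prod X_sc X_sc.
have mc := measurable_borel_pair XX_sc XX_sc mbar1 mid2.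
have [g gE] := is_pushforward_exists Phi mc.
exists g.
  split.
    apply: (is_pushforward_factor gE); last first.
      exact: measurable_borel_fst.
    exact: is_pushforward_comp Phimu bPsi.
  apply: (is_pushforward_factor gE); last first.
    exact: measurable_borel_snd.
  by split.
rewrite (is_pushforward_integral gE);
  [|by move=> z; rewrite lee_fin addr_ge0|exact: measurable_sqnormTX_dist].
rewrite (PhiE (fun z => (sqnormTX ((z.1, b z.1) - z))%:E)).
- apply: eq_integral => x _; apply: eq_integral => v _; congr EFin.
  by rewrite /sqnormTX/= subrr normr0 expr0n add0r distrC.
- by move=> z; rewrite lee_fin addr_ge0.
- exact: measurableT_comp measurable_sqnormTX_dist mc.
Qed.

Lemma bar_section_closed_convex mu (S : set (probability (borel (X * X)%type) R)) Phi Psi :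
  S `<=` @P2TX R X -> W2closed S -> totally_convex S ->
  S Phi -> is_pushforward fst Phi mu -> is_bar Phi mu Psi -> S Psi.
Proof.
move=> S2 Scl Sco SPhi Phimu Psibar.
have Phi2 := S2 _ SPhi.
apply: Scl; first exact: P2TX_bar Phimu Phi2 Psibar.
move: Psibar => [b [mb [k kE bE]] bPsi].
have PhiE := disintegration_law X_sc kE.
have [V [kV Vfin _]] := barycenter_variance dot_norm X_sc PhiE Phi2 mb bE.
set c : \bar R := (X in (X < +oo)%E) in Vfin.
have c0 : (0 <= c)%E by apply: integral_ge0 => x _; apply: integral_ge0 => v _; rewrite lee_fin.
have cfin : c \is a fin_num by rewrite ge0_fin_numE.
have mW (k' : R.-pker (borel X) ~> (borel X)) := measurable_kernel_variance X_sc k' mb.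
move=> e e0.
(* [c] is the variance of [Phi] integrated over [mu]; after [n] averagings the squared cost is
   [c / 2 ^+ n]. *)
have [n nc] : exists n, fine c / 2 ^+ n < e ^+ 2.
  have : (fine c * (2^-1 ^+ n)) @[n --> \oo] --> (fine c * 0 : R).
    by apply: cvgMr => //; apply: cvg_expr; rewrite ger0_norm// invf_lt1// ltr1n.
  rewrite mulr0 => /cvgr_dist_lt /(_ _ (exprn_gt0 2 e0)) [n _ /(_ n (leqnn n))].
  rewrite /= sub0r normrN => h; exists n; rewrite -exprVn.
  by apply: le_lt_trans h; rewrite ler_norm.
have [kn [Phin [PhinE SPhin knV]]] := average_iter X_sc S2 Sco n PhiE SPhi kV.
exists Phin => //.
have [g gc gE] := coupling_with_bar PhinE mb bPsi.
apply: (W2_lt_coupling gc _ e0 nc); rewrite gE.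
rewrite mulrC EFinM fineK// -ge0_integralZl_EFin//; last first.
  by move=> x _; apply: integral_ge0 => v _; rewrite lee_fin.
rewrite le_eqVlt; apply/orP; left; apply/eqP; apply: ae_eq_integral => //.
- exact: measurable_funeM.
- apply: filterS2 kV knV => x kx knx _.
  by rewrite kx knx -EFinM subrr normr0 expr0n !addr0 mulrC.
Qed.

End projections_to_barycenters.

(** * Dissipativity along couplings *)

Lemma ae_pushforward (R : realType) (T U : ptopologicalType) (f : T -> U)
    (P : probability (borel T) R) (Q : probability (borel U) R) (p : borel U -> Prop) :
  is_pushforward f P Q -> {ae Q, forall y, p y} ->
  {ae P, forall x : borel T, p (f x)}.
Proof.
move=> [mf QE] [N [mN N0 pN]]; exists (f @^-1` N); split.
- by rewrite -[X in measurable X]setTI; exact: mf.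
- exact: etrans (esym (QE N mN)) N0.
- by move=> x /= px; exact: pN.
Qed.

Section dissipative_pairs.
Context (R : realType) (X : completeNormedModType R) (dot : {dot X for idfun}).
Hypothesis dot_norm : forall x : X, dot x x = `|x| ^+ 2.
Hypothesis X_sc : @second_countable X.
Local Notation XX := (X * X)%type.
Implicit Types (mu : probability (borel X) R) (Phi Psi Xi : probability (borel XX) R).
Implicit Types theta : probability (borel (XX * XX)%type) R.

Let mX1 : measurable_fun setT ((fun z => z.1.1) : borel (XX * XX)%type -> borel X).
Proof.
apply: (measurableT_comp (f := (fst : borel XX -> borel X)));
  exact: measurable_borel_fst.
Qed.
Let mV1 : measurable_fun setT ((fun z => z.1.2) : borel (XX * XX)%type -> borel X).
Proof.
apply: (measurableT_comp (f := (snd : borel XX -> borel X)));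
  [exact: measurable_borel_snd|exact: measurable_borel_fst].
Qed.
Let mX2 : measurable_fun setT ((fun z => z.2.1) : borel (XX * XX)%type -> borel X).
Proof.
apply: (measurableT_comp (f := (fst : borel XX -> borel X)));
  [exact: measurable_borel_fst|exact: measurable_borel_snd].
Qed.
Let mV2 : measurable_fun setT ((fun z => z.2.2) : borel (XX * XX)%type -> borel X).
Proof.
apply: (measurableT_comp (f := (snd : borel XX -> borel X)));
  exact: measurable_borel_snd.
Qed.

(** Total dissipativity of one ordered pair of laws, so that the two arguments can be enlarged
    separately. *)
Definition dissipative_pair (lambda : R) Phi0 Phi1 :=
  forall theta, couplings Phi0 Phi1 theta ->
  (\int[theta]_z (dot (z.2.2 - z.1.2) (z.2.1 - z.1.1))%:E <=
   lambda%:E * \int[theta]_z (`|z.2.1 - z.1.1| ^+ 2)%:E)%E.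

(** The integral of the bound involves only the marginals of [theta]: it is [c] times the sum of the
    two second moments. *)
Lemma coupling_integrable Phi0 Phi1 theta (q : borel (XX * XX)%type -> borel X) (c : R) :
  couplings Phi0 Phi1 theta -> P2TX Phi0 -> P2TX Phi1 ->
  measurable_fun setT q -> 0 <= c ->
  (forall z : XX * XX, `|q z : X| ^+ 2 <= c * (sqnormTX z.1 + sqnormTX z.2)) ->
  theta.-integrable setT (fun z => (`|q z : X| ^+ 2)%:E).
Proof.
move=> [th0 th1] P0 P1 mq c0 qc.
have ms (i : XX * XX -> XX) : measurable_fun setT (i : borel (XX * XX)%type -> borel XX) ->
    measurable_fun setT (fun z : borel (XX * XX)%type => (sqnormTX (i z))%:E).
  exact: measurableT_comp (@measurable_sqnormTX R X).
have mf : measurable_fun setT (fst : borel (XX * XX)%type -> borel XX).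
  exact: measurable_borel_fst.
have msn : measurable_fun setT (snd : borel (XX * XX)%type -> borel XX).
  exact: measurable_borel_snd.
have s0 (y : XX) : (0 <= (sqnormTX y)%:E :> \bar R)%E by rewrite lee_fin addr_ge0.
have mq2 : measurable_fun setT (fun z : borel (XX * XX)%type => (`|q z : X| ^+ 2)%:E : \bar R).
  exact: measurable_vec_sqnorm.
apply/integrableP; split => //.
under eq_integral do rewrite abse_EFin ger0_norm ?exprn_ge0//.
apply: (@le_lt_trans _ _ (\int[theta]_z (c%:E * ((sqnormTX z.1)%:E + (sqnormTX z.2)%:E)))%E).
  apply: ge0_le_integral => //.
  - by apply: measurable_funeM; apply: emeasurable_funD; exact: ms.
  - by move=> z _; rewrite -EFinD -EFinM lee_fin; exact: qc.
rewrite ge0_integralZl_EFin//; last 2 first.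
- by move=> z _; exact: adde_ge0.
- by apply: emeasurable_funD; exact: ms.
rewrite ge0_integralD//; [|exact: ms|exact: ms].
rewrite -(is_pushforward_integral th0 s0 (@measurable_sqnormTX R X)).
rewrite -(is_pushforward_integral th1 s0 (@measurable_sqnormTX R X)).
apply: lte_mul_pinfty => //.
by rewrite lte_add_pinfty.
Qed.

(* With u = v1 - v0 and y = x1 - x0, the last identity integrates the
   polarization of dot u y, and C is the integral of |u - y|^2. *)
Lemma integral_dot_coupling Phi0 Phi1 theta :
  couplings Phi0 Phi1 theta -> P2TX Phi0 -> P2TX Phi1 ->
  exists A B C : R,
    [/\ (\int[theta]_z (`|z.2.2 - z.1.2| ^+ 2)%:E = A%:E)%E,
        (\int[theta]_z (`|z.2.1 - z.1.1| ^+ 2)%:E = B%:E)%E,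
        (\int[theta]_z (`|z.2.2 - (z.1.2 + (z.2.1 - z.1.1))| ^+ 2)%:E = C%:E)%E &
        (\int[theta]_z (dot (z.2.2 - z.1.2) (z.2.1 - z.1.1))%:E =
           (2^-1 * (A + B - C))%:E)%E].
Proof.
move=> th P0 P1.
have mU := measurable_vecB X_sc mV2 mV1.
have mY := measurable_vecB X_sc mX2 mX1.
have mUY := measurable_vecB X_sc mV2 (measurable_vecD X_sc mV1 mY).
have bd (u v : X) : `|u - v| ^+ 2 <= 2 * (`|u| ^+ 2 + `|v| ^+ 2).
  have h : `|u - v| ^+ 2 <= (`|u| + `|v|) ^+ 2 by rewrite ler_sqr ?nnegrE ?addr_ge0 ?ler_normB.
  by have := sqr_ge0 (`|u| - `|v|); nra.
have iA := coupling_integrable th P0 P1 mU (ler0n _ 2).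
have {}iA : theta.-integrable setT (fun z : borel (XX * XX)%type => (`|z.2.2 - z.1.2| ^+ 2)%:E).
  apply: iA => z /=; apply: le_trans (bd _ _) _.
  by rewrite ler_pM2l// /sqnormTX; have := sqr_ge0 `|z.1.1|; have := sqr_ge0 `|z.2.1|; lra.
have iB := coupling_integrable th P0 P1 mY (ler0n _ 2).
have {}iB : theta.-integrable setT (fun z : borel (XX * XX)%type => (`|z.2.1 - z.1.1| ^+ 2)%:E).
  apply: iB => z /=; apply: le_trans (bd _ _) _.
  by rewrite ler_pM2l// /sqnormTX; have := sqr_ge0 `|z.1.2|; have := sqr_ge0 `|z.2.2|; lra.
have iC := coupling_integrable th P0 P1 mUY (ler0n _ 8).
have {}iC : theta.-integrable setT
    (fun z : borel (XX * XX)%type => (`|z.2.2 - (z.1.2 + (z.2.1 - z.1.1))| ^+ 2)%:E).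
  (* Two nested uses of [bd] give the factor 4, within the 8 allowed. *)
  apply: iC => z /=; rewrite opprD addrA; apply: le_trans (bd _ _) _.
  have := bd z.2.2 z.1.2; have := bd z.2.1 z.1.1; rewrite /sqnormTX.
  by have := sqr_ge0 `|z.1.2|; have := sqr_ge0 `|z.2.2|; have := sqr_ge0 `|z.1.1|;
    have := sqr_ge0 `|z.2.1|; lra.
have /fineK AE := integrable_fin_num measurableT iA.
have /fineK BE := integrable_fin_num measurableT iB.
have /fineK CE := integrable_fin_num measurableT iC.
exists (fine (\int[theta]_z (`|z.2.2 - z.1.2| ^+ 2)%:E)%E),
  (fine (\int[theta]_z (`|z.2.1 - z.1.1| ^+ 2)%:E)%E),
  (fine (\int[theta]_z (`|z.2.2 - (z.1.2 + (z.2.1 - z.1.1))| ^+ 2)%:E)%E).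
split; [by rewrite AE|by rewrite BE|by rewrite CE|].
rewrite EFinM EFinB EFinD AE BE CE.
rewrite -integralD// -integralB//; last exact: integrableD.
rewrite -integralZl//; last by apply: integrableB => //; exact: integrableD.
apply: eq_integral => z _; rewrite (dot_polarization dot_norm).
by rewrite (opprD z.1.2) addrA.
Qed.

(** The law [theta'] is that of [(x0, v0, x1, v)] with [v] drawn from [k x1]. Its second marginal is
    [Phi] because [x1] has law [mu] under [theta]. Squares are compared instead of the products
    themselves, since the kernel formula covers nonnegative functions. *)
Lemma coupling_lift mu Phi Psi Xi theta :
  is_pushforward fst Phi mu -> P2TX Phi -> is_bar Phi mu Psi -> P2TX Xi ->
  couplings Xi Psi theta ->
  exists2 theta', couplings Xi Phi theta' &
    (\int[theta']_z (dot (z.2.2 - z.1.2) (z.2.1 - z.1.1))%:E =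
     \int[theta]_z (dot (z.2.2 - z.1.2) (z.2.1 - z.1.1))%:E)%E /\
    (\int[theta']_z (`|z.2.1 - z.1.1| ^+ 2)%:E =
     \int[theta]_z (`|z.2.1 - z.1.1| ^+ 2)%:E)%E.
Proof.
move=> Phimu Phi2 Psibar Xi2 [th0 th1].
have Psi2 := P2TX_bar dot_norm X_sc Phimu Phi2 Psibar.
move: Psibar => [b [mb [k kE bE]] bPsi].
have PhiE := disintegration_law X_sc kE.
have [V [kV Vfin _]] := barycenter_variance dot_norm X_sc PhiE Phi2 mb bE.
have XX_sc := second_countable_prod X_sc X_sc.
have XXXX_sc := second_countable_prod XX_sc XX_sc.
have [K KE] := kernel_comp_measurable k mX2.
have [Th ThE] := law_from_kernel_exists XXXX_sc X_sc theta K.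
have Thfst := law_from_kernel_fst ThE.
have ch : continuous (fun w : (XX * XX) * X => (w.1.1, (w.1.2.1, w.2))).
  apply: continuous_pair.
    by move=> w; apply: (continuous_comp (f := fst) (g := fst)); exact: continuous_fst.
  apply: continuous_pair; last exact: continuous_snd.
  move=> w; apply: (@continuous_comp _ _ _ (fun w : (XX * XX) * X => w.1.2) fst w).
    by apply: (continuous_comp (f := fst) (g := snd));
      [exact: continuous_fst|exact: continuous_snd].
  exact: continuous_fst.
have mh := continuous_borel ch.
have [theta' th'E] := is_pushforward_exists Th mh.
have {}ThE (g : borel (XX * XX)%type -> \bar R) : (forall z, 0 <= g z)%E -> measurable_fun setT g ->
    (\int[theta']_z g z = \int[theta]_z \int[k z.2.1]_v g (z.1, (z.2.1, (v : X))))%E.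
  move=> g0 mg; rewrite (is_pushforward_integral th'E)//.
  rewrite (ThE (fun w => g (w.1.1, (w.1.2.1, w.2)))); last 2 first.
  - by move=> w; exact: g0.
  - exact: measurableT_comp mg mh.
  by apply: eq_integral => z _; rewrite KE.
have mW := measurable_kernel_variance X_sc k mb.
have mfX : measurable_fun setT (fst : borel XX -> borel X).
  exact: measurable_borel_fst.
have Psimu : is_pushforward fst Psi mu.
  by apply: (is_pushforward_factor bPsi) => //; split => //; exact: measurable_id.
have thmu := is_pushforward_comp th1 Psimu.
have W0 x : (0 <= \int[k x]_v (`|(v : X) - b x| ^+ 2)%:E)%E.
  by apply: integral_ge0 => v _; rewrite lee_fin.
set c := (X in (X < +oo)%E) in Vfin.
have c0 : (0 <= c)%E by exact: integral_ge0.
have /fineK cE : c \is a fin_num by rewrite ge0_fin_numE.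
have thc : (\int[theta]_z \int[k z.2.1]_v (`|(v : X) - b z.2.1| ^+ 2)%:E = c)%E.
  by rewrite /c (is_pushforward_integral thmu).
(* The second marginal [Psi] of [theta] is concentrated on the graph of [b]. *)
have ae_b : {ae theta, forall z : borel (XX * XX)%type, z.2.2 = b z.2.1}.
  apply: (ae_pushforward th1 (p := fun y : borel XX => y.2 = b y.1)).
  have mD := measurable_sqdist_graph X_sc mb.
  set D := (fun y : borel XX => _) in mD.
  have mN : measurable (~` (D @^-1` [set 0%E])).
    apply: measurableC; rewrite -[X in measurable X]setTI.
    by apply: mD => //; exact: emeasurable_set1.
  exists (~` (D @^-1` [set 0%E])); split => //.
    rewrite bPsi.2// /pushforward preimage_setC -[RHS](measure0 mu).
    congr (mu _); apply/seteqP; split=> x //=.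
    by rewrite /D/= subrr normr0 expr0n.
  move=> y /= yb [] /eqP; rewrite sqrf_eq0 normr_eq0 subr_eq0 => /eqP; exact: yb.
have ae_V := ae_pushforward thmu kV.
(* Resampling v1 from k x1 adds the variance c to the mean square of v1 - m,
   whatever m depending on (x0, v0, x1); the two copies of c cancel in the
   polarization identity. *)
have lift_sq (m : XX * X -> X) : measurable_fun setT (m : borel (XX * X)%type -> borel X) ->
    (\int[theta']_z (`|z.2.2 - m (z.1, z.2.1)| ^+ 2)%:E =
     c + \int[theta]_z (`|z.2.2 - m (z.1, z.2.1)| ^+ 2)%:E)%E.
  move=> mm.
  have mmz : measurable_fun setT ((fun z => m (z.1, z.2.1)) : borel (XX * XX)%type -> borel X).
    have mf : measurable_fun setT (fst : borel (XX * XX)%type -> borel XX).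
      exact: measurable_borel_fst.
    exact: measurableT_comp mm (measurable_borel_pair XX_sc X_sc mf mX2).
  have msq := measurable_vec_sqnorm (measurable_vecB X_sc mV2 mmz).
  have m1 := measurableT_comp mW mX2.
  rewrite ThE; [|by move=> z; rewrite lee_fin|exact: msq].
  rewrite -thc -ge0_integralD//.
  apply: ae_eq_integral => //.
  - have [K' K'E] := kernel_comp_measurable k mX2.
    pose G (w : borel ((XX * XX) * X)%type) : \bar R :=
      (`|w.2 - m (w.1.1, w.1.2.1)| ^+ 2)%:E.
    apply: (eq_measurable_fun (fun z => \int[K' z]_v G ((z : XX * XX), (v : X)))%E).
      by move=> z _; rewrite K'E.
    apply: measurable_kernel_integral => //; first by move=> w; rewrite lee_fin.
    exact: measurableT_comp msq mh.
  - exact: emeasurable_funD.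
  (* [mean_var] is used at [m (z.1, z.2.1)] for the left side and at the barycenter for the
     variance; [z.2.2] is the barycenter almost everywhere. *)
  - apply: filterS2 ae_b ae_V => z zb zV _ /=.
    by rewrite zV zV zb subrr normr0 expr0n addr0 EFinD.
have cth' : couplings Xi Phi theta'.
  split.
    apply: (is_pushforward_factor th'E); last first.
      exact: measurable_borel_fst.
    exact: (is_pushforward_comp Thfst th0).
  have ms : measurable_fun setT (snd : borel (XX * XX)%type -> borel XX).
    exact: measurable_borel_snd.
  apply: integral_is_pushforward => // g g0 mg.
  rewrite (ThE (fun z => g z.2)); [|by move=> z; exact: g0|exact: measurableT_comp mg ms].
  rewrite (PhiE g g0 mg).
  have mG := measurable_kernel_integral X_sc X_sc k g0 mg.
  rewrite (is_pushforward_integral thmu)// => x; exact: integral_ge0.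
exists theta' => //.
have B'E : (\int[theta']_z (`|z.2.1 - z.1.1| ^+ 2)%:E =
     \int[theta]_z (`|z.2.1 - z.1.1| ^+ 2)%:E)%E.
  rewrite ThE.
  - apply: eq_integral => z _ /=.
    by rewrite integral_cst// prob_kernel mule1.
  - by move=> z; rewrite lee_fin.
  - exact: measurable_vec_sqnorm (measurable_vecB X_sc mX2 mX1).
split => //.
have [A [B [C [AE BE CE ->]]]] := integral_dot_coupling (conj th0 th1) Xi2 Psi2.
have [A' [B' [C' [A'E B'E' C'E ->]]]] := integral_dot_coupling cth' Xi2 Phi2.
have ->: B' = B by apply/EFin_inj; rewrite -B'E' -BE.
have mfy : measurable_fun setT (fst : borel (XX * X)%type -> borel XX).
  exact: measurable_borel_fst.
have msy : measurable_fun setT (snd : borel (XX * X)%type -> borel X).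
  exact: measurable_borel_snd.
have msX : measurable_fun setT (snd : borel XX -> borel X).
  exact: measurable_borel_snd.
(* [lift_sq] with [m = v0] for [A], and below with [m = v0 + (x1 - x0)] for [C]. *)
have ->: A' = fine c + A.
  apply/EFin_inj; rewrite EFinD cE -A'E -AE.
  exact: (lift_sq (fun y => y.1.2) (measurableT_comp msX mfy)).
have ->: C' = fine c + C.
  apply/EFin_inj; rewrite EFinD cE -C'E -CE.
  apply: (lift_sq (fun y => y.1.2 + (y.2 - y.1.1))).
  apply: (measurable_vecD X_sc); first exact: measurableT_comp msX mfy.
  apply: (measurable_vecB X_sc) => //; exact: measurableT_comp mfX mfy.
by congr EFin; ring.
Qed.

(** Exchanging the arguments reverses both differences, which leaves their product unchanged. The
    change of variables is again carried out on the three squares. *)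
Lemma dissipative_pair_sym lambda Phi0 Phi1 :
  dissipative_pair lambda Phi0 Phi1 -> P2TX Phi0 -> P2TX Phi1 ->
  dissipative_pair lambda Phi1 Phi0.
Proof.
move=> d01 P0 P1 theta th.
have ms : measurable_fun setT
    ((fun z => (z.2, z.1)) : borel (XX * XX)%type -> borel (XX * XX)%type).
  by apply: continuous_borel; apply: continuous_pair; [exact: continuous_snd|exact: continuous_fst].
have [theta' th'] := is_pushforward_exists theta ms.
have cth' : couplings Phi0 Phi1 theta'.
  split; apply: (is_pushforward_factor th').
  - exact: th.2.
  - exact: measurable_borel_fst.
  - exact: th.1.
  - exact: measurable_borel_snd.
have := d01 _ cth'.
have [A [B [C [AE BE CE ->]]]] := integral_dot_coupling th P1 P0.
have [A' [B' [C' [A'E B'E C'E ->]]]] := integral_dot_coupling cth' P0 P1.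
have tr (q : borel (XX * XX)%type -> borel X) : measurable_fun setT q ->
    (\int[theta']_z (`|q z : X| ^+ 2)%:E = \int[theta]_z (`|q (z.2, z.1) : X| ^+ 2)%:E)%E.
  move=> mq.
  have q0 (z : borel (XX * XX)%type) : (0 <= (`|q z : X| ^+ 2)%:E :> \bar R)%E by rewrite lee_fin.
  exact: (is_pushforward_integral th' q0 (measurable_vec_sqnorm mq)).
have mU := measurable_vecB X_sc mV2 mV1.
have mY := measurable_vecB X_sc mX2 mX1.
have mUY := measurable_vecB X_sc mV2 (measurable_vecD X_sc mV1 mY).
have -> : A' = A.
  apply/EFin_inj; rewrite -A'E -AE (tr _ mU).
  by apply: eq_integral => z _; rewrite distrC.
have -> : C' = C.
  apply/EFin_inj; rewrite -C'E -CE (tr _ mUY).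
  apply: eq_integral => z _ /=; rewrite -normrN; congr (`|_| ^+ 2)%:E.
  by rewrite opprB (opprD z.1.2) opprB -addrA (addrC (- _)).
rewrite BE B'E; have -> // : B' = B.
apply/EFin_inj; rewrite -B'E -BE (tr _ mY).
by apply: eq_integral => z _; rewrite distrC.
Qed.

Lemma dissipative_pair_bar lambda mu Phi Psi Xi :
  is_pushforward fst Phi mu -> P2TX Phi -> is_bar Phi mu Psi -> P2TX Xi ->
  dissipative_pair lambda Xi Phi -> dissipative_pair lambda Xi Psi.
Proof.
move=> Phimu Phi2 Psibar Xi2 d theta th.
have [theta' cth' [<- <-]] := coupling_lift Phimu Phi2 Psibar Xi2 th.
exact: d.
Qed.

End dissipative_pairs.

(** * Closed totally convex sections, and maximal fields *)

Theorem theorem3p18 (R : realType) (X : completeNormedModType R)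
    (dot : {dot X for idfun})
    (dot_norm : forall x : X, dot x x = `|x| ^+ 2)
    (X_separable : exists2 D : set X, countable D & dense D)
    (F : set (probability (borel (X * X)%type) R))
    (F_mpvf : MPVF F) :
  (forall mu : probability (borel X) R, MPVFdom F mu ->
     W2closed (MPVFsection F mu) ->
     totally_convex (MPVFsection F mu) ->
     bar_section F mu `<=` MPVFsection F mu) /\
  (forall lambda : R, maximal_totally_dissipative dot lambda F ->
     bar F `<=` F).
Proof.
have X_sc := second_countable_normed X_separable.
have [F0 F2 Flaw] := F_mpvf.
split=> [mu _ Fcl Fco Psi [Phi FPhi Psibar]|lambda [_ Fdiss Fmax]].
  apply: (bar_section_closed_convex dot_norm X_sc _ Fcl Fco FPhi FPhi.2 Psibar).
  by move=> Phi' [/F2].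
have bar2 : bar F `<=` @P2TX R X.
  move=> Psi [mu _ [Phi [FPhi Phimu] Psibar]].
  exact: (P2TX_bar dot_norm X_sc Phimu (F2 _ FPhi) Psibar).
have G2 : F `|` bar F `<=` @P2TX R X by move=> Psi [/F2|/bar2].
(* Enlarges the second argument from [F] to the union, for any fixed first argument of finite second
   moment. *)
have extend Xi : P2TX Xi -> (forall Phi, F Phi -> dissipative_pair dot lambda Xi Phi) ->
    forall Psi, (F `|` bar F) Psi -> dissipative_pair dot lambda Xi Psi.
  move=> Xi2 XiF Psi [/XiF//|[mu _ [Phi [FPhi Phimu] Psibar]]].
  exact: (dissipative_pair_bar dot_norm X_sc Phimu (F2 _ FPhi) Psibar Xi2 (XiF _ FPhi)).
suff : F `|` bar F `<=` F by move=> GF Psi barPsi; apply: GF; right.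
apply: Fmax; last by move=> Phi FPhi; left.
  split=> [|//|Psi Psi' PsiPsi' [FPsi|]].
  - by have [Phi FPhi] := F0; exists Phi; left.
  - by left; exact: Flaw PsiPsi' FPsi.
  (* The same [mu], [Phi] and [b] serve for [Psi'], since being a pushforward depends only on the
     values on measurable sets. *)
  move=> [mu mudom [Phi PhiF [b bb [mb Psib]]]]; right.
  exists mu => //; exists Phi => //; exists b => //; split=> // A mA.
  by rewrite -PsiPsi'// Psib.
(* [extend] reduces [Psi1] to an element of [F]; after exchanging the arguments, a second [extend]
   reduces [Psi0] likewise. *)
move=> Psi0 Psi1 GPsi0 GPsi1; apply: (extend Psi0 (G2 _ GPsi0)) => // Phi FPhi.
apply: (dissipative_pair_sym dot_norm X_sc); [|exact: F2|exact: G2].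
apply: (extend Phi (F2 _ FPhi)) => // Phi' FPhi'.
exact: Fdiss.
Qed.
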